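(* For $n\geq 1$ and $m\geq 2$, the total resonance graph $R_t(T(2n+1,2m))$ has exactly two components.
   Context: $T(2n+1,2m)$ is the graph with vertices $(u_i,v_j)$, $i\in\mathbb{Z}_{2m}$, $j\in\mathbb{Z}_{2n+1}$, where $(u_i,v_j)$ is adjacent to $(u_{i+1},v_j)$ and $(u_i,v_{j+1})$, cellularly embedded in the torus with faces the $4$-cycles $(u_i,v_j)(u_{i+1},v_j)(u_{i+1},v_{j+1})(u_i,v_{j+1})$. The total resonance graph $R_t(G)$ has the perfect matchings of $G$ as vertices, two perfect matchings $M,M'$ being adjacent iff $M\oplus M'$ (symmetric difference) is exactly the boundary of one face. *)

(* Defs.v *)
From mathcomp Require Import all_boot.
Set Implicit Arguments. Unset Strict Implicit. Unset Printing Implicit Defensive.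

(* The toroidal grid T(2n+1,2m): vertices (u_i, v_j), i in Z_{2m}, j in Z_{2n+1}. *)
Definition tvert (n m : nat) : finType := ('I_(2 * m) * 'I_(2 * n + 1))%type.

(* Edges: (x, false) is the edge x=(u_i,v_j) -- (u_{i+1},v_j);
          (x, true)  is the edge x=(u_i,v_j) -- (u_i,v_{j+1}).
   For m >= 2 and n >= 1 this is a bijection with the edge set of the
   (simple) graph T(2n+1,2m). *)
Definition tedge (n m : nat) : finType := (tvert n m * bool)%type.

Definition tsucc_u n m (x : tvert n m) : tvert n m := (ordS x.1, x.2).
Definition tsucc_v n m (x : tvert n m) : tvert n m := (x.1, ordS x.2).

Definition tend1 n m (e : tedge n m) : tvert n m := e.1.
Definition tend2 n m (e : tedge n m) : tvert n m :=
  if e.2 then tsucc_v e.1 else tsucc_u e.1.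

Definition incident n m (x : tvert n m) (e : tedge n m) : bool :=
  (tend1 e == x) || (tend2 e == x).

Definition perfect_matching n m (M : {set tedge n m}) : bool :=
  [forall x : tvert n m, #|[set e in M | incident x e]| == 1].

(* Boundary of the face with corners (u_i,v_j),(u_{i+1},v_j),(u_{i+1},v_{j+1}),(u_i,v_{j+1}). *)
Definition face_boundary n m (x : tvert n m) : {set tedge n m} :=
  [set (x, false); (x, true); (tsucc_u x, true); (tsucc_v x, false)].

Definition symdiff (T : finType) (A B : {set T}) : {set T} := (A :\: B) :|: (B :\: A).

Definition PM (n m : nat) : finType := {M : {set tedge n m} | perfect_matching M}.

Definition resonance_adj n m : rel (PM n m) :=
  fun M M' => [exists x : tvert n m, symdiff (val M) (val M') == face_boundary x].

Definition num_components_Rt (n m : nat) : nat :=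
  n_comp (@resonance_adj n m) (pred_of_simpl predT).

(* Main.v *)
Require Import Defs.
From mathcomp Require Import all_boot.
From mathcomp Require Import all_order all_algebra zify.

(** Weight the horizontal edges of a perfect matching [M] by alternating signs
    along a column: [q x = sum_(j < 2n+1) (-1)^j [M contains the horizontal edge
    at v^(j+1) x]].  Because the column length is odd, [q] is well defined on the
    torus itself, and [M <-> q] is a bijection between perfect matchings and
    integer functions with [q x + q (v x)] in {0, 2} and [q x + q (u x)] in
    {1, -1}.  On the bipartite double cover, [4q - 1] on one colour class and
    [1 - 4q] on the other form the usual height function, and a flip at the face
    [x] changes [q x] by 2 and nothing else.  Hence the parity of [q] at a fixed
    face is invariant, and two matchings with the same parity are joined by
    moving the first one, at an extremal face where they differ, towards the
    second.  The two values of the parity are attained by the matchings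
    consisting of all horizontal edges in alternate columns of faces. *)

Set Implicit Arguments. Unset Strict Implicit. Unset Printing Implicit Defensive.
Import Order.TTheory GRing.Theory Num.Theory.

Local Open Scope ring_scope.

(** * Cyclic shifts, the torus grid and the degree condition *)

Lemma val_iter_ordS (N k : nat) (i : 'I_N) : iter k (@ordS N) i = ((i + k) %% N)%N :> nat.
Proof.
elim: k => [|k IHk]; first by rewrite addn0 modn_small.
by rewrite iterS /= IHk -addn1 modnDml addn1 addnS.
Qed.

Lemma iter_ordS_id (N : nat) (i : 'I_N) : iter N (@ordS N) i = i.
Proof. by apply: val_inj; rewrite /= val_iter_ordS modnDr modn_small. Qed.

Lemma iter_ordS_reach (N : nat) (i j : 'I_N) : exists k, iter k (@ordS N) i = j.
Proof.
exists (j + (N - i))%N; apply: val_inj; rewrite /= val_iter_ordS.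
by rewrite addnCA subnKC 1?ltnW // modnDr modn_small.
Qed.

Lemma ordS_neq (N : nat) (i : 'I_N) : (1 < N)%N -> ordS i != i.
Proof.
move=> N1; apply/eqP => /(congr1 val) /=.
have := ltn_ord i; rewrite leq_eqVlt => /orP[/eqP iN|iN].
  by rewrite iN modnn => i0; rewrite -i0 in iN; lia.
by rewrite modn_small //; lia.
Qed.

Definition tpred_u (n m : nat) (x : tvert n m) : tvert n m := (ord_pred x.1, x.2).
Definition tpred_v (n m : nat) (x : tvert n m) : tvert n m := (x.1, ord_pred x.2).

Lemma tsucc_uK (n m : nat) : cancel (@tsucc_u n m) (@tpred_u n m).
Proof. by case=> i j; rewrite /tsucc_u /tpred_u /= ordSK. Qed.

Lemma tpred_uK (n m : nat) : cancel (@tpred_u n m) (@tsucc_u n m).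
Proof. by case=> i j; rewrite /tsucc_u /tpred_u /= ord_predK. Qed.

Lemma tsucc_vK (n m : nat) : cancel (@tsucc_v n m) (@tpred_v n m).
Proof. by case=> i j; rewrite /tsucc_v /tpred_v /= ordSK. Qed.

Lemma tpred_vK (n m : nat) : cancel (@tpred_v n m) (@tsucc_v n m).
Proof. by case=> i j; rewrite /tsucc_v /tpred_v /= ord_predK. Qed.

Lemma iter_tsucc_v (n m k : nat) (x : tvert n m) :
  iter k (@tsucc_v n m) x = (x.1, iter k (@ordS _) x.2).
Proof. by elim: k => [|k IHk]; [case: x | rewrite !iterS IHk]. Qed.

Lemma iter_tsucc_v_id (n m : nat) (x : tvert n m) :
  iter (2 * n + 1) (@tsucc_v n m) x = x.
Proof. by rewrite iter_tsucc_v iter_ordS_id; case: x. Qed.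

Lemma iter_tsucc_vu (n m k : nat) (x : tvert n m) :
  iter k (@tsucc_v n m) (tsucc_u x) = tsucc_u (iter k (@tsucc_v n m) x).
Proof. by rewrite !iter_tsucc_v. Qed.

Lemma torus_ind (n m : nat) (P : tvert n m -> Prop) (o : tvert n m) :
  P o -> (forall x, P x -> P (tsucc_u x)) -> (forall x, P x -> P (tsucc_v x)) ->
  forall x, P x.
Proof.
case: o => i j Po Pu Pv [i' j'].
have [k <-] := iter_ordS_reach i i'; have [l <-] := iter_ordS_reach j j'.
elim: l => [|l IHl]; last exact: Pv IHl.
by elim: k => [|k IHk]; last exact: Pu IHk.
Qed.

Lemma tsucc_u_neq (n m : nat) (x : tvert n m) : (2 <= m)%N -> tsucc_u x != x.
Proof.
move=> m2; case: x => i j; rewrite xpair_eqE negb_and ordS_neq //; lia.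
Qed.

Lemma tsucc_v_neq (n m : nat) (x : tvert n m) : (1 <= n)%N -> tsucc_v x != x.
Proof.
move=> n1; case: x => i j; rewrite xpair_eqE negb_and orbC ordS_neq //; lia.
Qed.

(* Every vertex is the upper right corner of a unique face, so the degree
   condition is stated at the corner opposite to [z]. *)
Lemma card_incident (n m : nat) (M : {set tedge n m}) (z : tvert n m) :
  (1 <= n)%N -> (2 <= m)%N ->
  #|[set e in M | incident (tsucc_u (tsucc_v z)) e]| =
  (((tsucc_u (tsucc_v z), false) \in M) + ((tsucc_u (tsucc_v z), true) \in M)
   + ((tsucc_v z, false) \in M) + ((tsucc_u z, true) \in M))%N.
Proof.
move=> n1 m2; set w := tsucc_u _.
have -> : [set e in M | incident w e] =
    [set e in [:: (w, false); (w, true); (tsucc_v z, false); (tsucc_u z, true)] | e \in M].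
  apply/setP => -[y c]; rewrite !inE andbC; congr (_ && _).
  rewrite /incident /tend1 /tend2 /= !xpair_eqE.
  case: c; rewrite /= ?eqbF_neg ?eqb_id ?andbF ?andbT ?orbF /=; congr (_ || _).
    by rewrite -[RHS](inj_eq (can_inj (@tsucc_vK n m))).
  by rewrite -[RHS](inj_eq (can_inj (@tsucc_uK n m))).
rewrite cardsE -sum1_card big_mkcondr /= -big_uniq /=.
  rewrite !big_cons big_nil; do 4 case: (_ \in M) => //=.
(* The four listed edges are distinct because neither cyclic shift has a fixed point. *)
rewrite /= !inE !xpair_eqE !andbF !andbT !orbF /=.
by rewrite !eqxx andbT !ordS_neq //; lia.
Qed.

Lemma perfect_matchingP (n m : nat) (M : {set tedge n m}) :
  (1 <= n)%N -> (2 <= m)%N ->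
  reflect (forall z : tvert n m,
      (((tsucc_u (tsucc_v z), false) \in M) + ((tsucc_u (tsucc_v z), true) \in M)
       + ((tsucc_v z, false) \in M) + ((tsucc_u z, true) \in M) = 1)%N)
    (perfect_matching M).
Proof.
move=> n1 m2; apply: (iffP forallP) => [PM z|PM x].
  by rewrite -card_incident //; apply/eqP/PM.
by rewrite -(tpred_uK x) -(tpred_vK (tpred_u x)) card_incident // PM.
Qed.

(** * Perfect matchings and height functions *)

Lemma sum_alternating (F : nat -> int) (k : nat) :
  \sum_(0 <= j < k) (-1) ^+ j * (F j + F j.+1) = F 0%N - (-1) ^+ k * F k.
Proof.
elim: k => [|k IHk]; first by rewrite big_nil expr0; lia.
by rewrite big_nat_recr //= IHk exprS; lia.
Qed.

Definition height (n m : nat) (M : {set tedge n m}) (x : tvert n m) : int :=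
  \sum_(0 <= j < 2 * n + 1)
    (-1) ^+ j * Posz ((iter j.+1 (@tsucc_v n m) x, false) \in M).

Lemma sign_odd_size (n : nat) : (-1) ^+ (2 * n + 1) = -1 :> int.
Proof. by rewrite exprD exprM sqrrN !expr1n mul1r. Qed.

(** The sum telescopes around the column; its length is odd, so the two end terms add up instead of
    cancelling. *)
Lemma height_v (n m : nat) (M : {set tedge n m}) (x : tvert n m) :
  height M x + height M (tsucc_v x) = 2 * Posz ((tsucc_v x, false) \in M).
Proof.
rewrite /height -big_split /=.
under eq_bigr => j _ do rewrite -mulrDr -iterS iterSr.
have := sum_alternating
  (fun j => Posz ((iter j (@tsucc_v n m) (tsucc_v x), false) \in M)) (2 * n + 1).
rewrite sign_odd_size iter_tsucc_v_id /= => ->; lia.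
Qed.

Lemma height_u (n m : nat) (M : {set tedge n m}) (x : tvert n m) :
  (1 <= n)%N -> (2 <= m)%N -> perfect_matching M ->
  height M x + height M (tsucc_u x) = 1 - 2 * Posz ((tsucc_u x, true) \in M).
Proof.
move=> n1 m2 /(perfect_matchingP _ n1 m2) PM.
(* After doubling, the degree condition turns each summand into [(1 - 2 * a) + (1 - 2 * b)], with
   [a] and [b] the indicators of consecutive vertical edges, and the sum telescopes as before. *)
suff: 2 * (height M x + height M (tsucc_u x)) =
      2 * (1 - 2 * Posz ((tsucc_u x, true) \in M)) by lia.
rewrite /height -big_split mulr_sumr /=.
have := sum_alternating
  (fun j => 1 - 2 * Posz ((tsucc_u (iter j (@tsucc_v n m) x), true) \in M)) (2 * n + 1).
rewrite sign_odd_size iter_tsucc_v_id /= => e.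
transitivity (1 - 2 * Posz ((tsucc_u x, true) \in M)
  - -1 * (1 - 2 * Posz ((tsucc_u x, true) \in M))); last by case: (_ \in M).
rewrite -e; apply: eq_bigr => j _.
rewrite -mulrDr mulrCA; congr (_ * _).
have := PM (iter j (@tsucc_v n m) x); rewrite iter_tsucc_vu; do 4 case: (_ \in M) => //.
Qed.

Definition is_height (n m : nat) (q : tvert n m -> int) : Prop :=
  forall x, (q x + q (tsucc_v x) = 0 \/ q x + q (tsucc_v x) = 2) /\
            (q x + q (tsucc_u x) = 1 \/ q x + q (tsucc_u x) = -1).

(** The edge at a vertex separates two faces, named by their lower left corners: that vertex and its
    predecessor in the direction across the edge. *)
Definition matching_of (n m : nat) (q : tvert n m -> int) : {set tedge n m} :=
  [set e | if e.2 then q (tpred_u e.1) + q e.1 == -1 else q (tpred_v e.1) + q e.1 == 2].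

Lemma in_matching_of_v (n m : nat) (q : tvert n m -> int) (x : tvert n m) :
  ((tsucc_v x, false) \in matching_of q) = (q x + q (tsucc_v x) == 2).
Proof. by rewrite inE /= tsucc_vK. Qed.

Lemma in_matching_of_u (n m : nat) (q : tvert n m -> int) (x : tvert n m) :
  ((tsucc_u x, true) \in matching_of q) = (q x + q (tsucc_u x) == -1).
Proof. by rewrite inE /= tsucc_uK. Qed.

Lemma is_height_height (n m : nat) (M : {set tedge n m}) :
  (1 <= n)%N -> (2 <= m)%N -> perfect_matching M -> is_height (height M).
Proof.
by move=> n1 m2 PM x; rewrite height_v height_u //; split; case: (_ \in _); lia.
Qed.

Lemma heightK (n m : nat) (M : {set tedge n m}) :
  (1 <= n)%N -> (2 <= m)%N -> perfect_matching M -> matching_of (height M) = M.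
Proof.
move=> n1 m2 PM; apply/setP => -[x []].
  by rewrite -(tpred_uK x) in_matching_of_u height_u //; case: (_ \in _).
by rewrite -(tpred_vK x) in_matching_of_v height_v //; case: (_ \in _).
Qed.

Lemma eq_matching_of (n m : nat) (q q' : tvert n m -> int) :
  q =1 q' -> matching_of q = matching_of q'.
Proof. by move=> qq'; apply/setP => -[x c]; rewrite !inE /= !qq'. Qed.

(** With [a] and [b] the values on the two sides, the indicator of an edge is [(a + b) / 2] if
    horizontal and [(1 - a - b) / 2] if vertical. Around a vertex each of the four faces occurs once
    with each sign, which leaves 1. *)
Lemma perfect_matching_of (n m : nat) (q : tvert n m -> int) :
  (1 <= n)%N -> (2 <= m)%N -> is_height q -> perfect_matching (matching_of q).
Proof.
move=> n1 m2 qP; apply/perfect_matchingP => // z.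
rewrite (in_matching_of_u q z) (in_matching_of_u q (tsucc_v z)).
rewrite (in_matching_of_v q z) (in_matching_of_v q (tsucc_u z)).
have [] := qP z; have [_] := qP (tsucc_v z); have [+ _] := qP (tsucc_u z).
rewrite -[tsucc_u (tsucc_v z)]/(tsucc_v (tsucc_u z)); lia.
Qed.

(** The difference of the two functions changes sign at each step along [v]; after an odd cycle it
    equals its own negative. *)
Lemma matching_ofK (n m : nat) (q : tvert n m -> int) :
  is_height q -> height (matching_of q) =1 q.
Proof.
move=> qP x.
have e k : height (matching_of q) (iter k (@tsucc_v n m) x)
    - q (iter k (@tsucc_v n m) x) = (-1) ^+ k * (height (matching_of q) x - q x).
  elim: k => [|k IHk]; first by rewrite mul1r.
  rewrite exprS -mulrA -IHk iterS; set y := iter k _ x.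
  by have := height_v (matching_of q) y; rewrite in_matching_of_v; have [] := qP y; lia.
by have := e (2 * n + 1)%N; rewrite iter_tsucc_v_id sign_odd_size; lia.
Qed.

(** * Flips and the parity invariant *)

(** Membership of an edge depends only on the sum over its two distinct faces. If one of them is
    [x], the sum moves to its other admissible value and membership toggles. *)
Lemma symdiff_matching_of (n m : nat) (q q1 : tvert n m -> int) (x : tvert n m) :
  (1 <= n)%N -> (2 <= m)%N -> is_height q -> is_height q1 ->
  q1 x != q x -> (forall y, y != x -> q1 y = q y) ->
  symdiff (matching_of q) (matching_of q1) = face_boundary x.
Proof.
move=> n1 m2 qP q1P q1x q1y; apply/setP => -[y c].
have e : ((y, c) \in symdiff (matching_of q) (matching_of q1)) =
  (((y, c) \in matching_of q) != ((y, c) \in matching_of q1)).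
  rewrite /symdiff in_setU !in_setD; do 2 case: (_ \in matching_of _) => //.
rewrite {}e /face_boundary !in_setU !in_set1 !xpair_eqE; case: c => /=.
  rewrite !andbF !andbT !orbF /=; rewrite -(tpred_uK y); move: (tpred_u y) => z.
  rewrite !in_matching_of_u (inj_eq (can_inj (@tsucc_uK n m))).
  have [_ H] := qP z; have [_ H1] := q1P z; have := tsucc_u_neq z m2.
  have [zx|zx] := eqVneq z x; have [uzx|uzx] := eqVneq (tsucc_u z) x.
  - by rewrite uzx zx eqxx.
  - by move=> _ /=; have := q1y _ uzx; subst z; lia.
  - by move=> _ /=; have := q1y _ zx; rewrite uzx in H H1 *; lia.
  - by move=> _ /=; have := q1y _ zx; have := q1y _ uzx; lia.
rewrite !andbF !andbT !orbF /=; rewrite -(tpred_vK y); move: (tpred_v y) => z.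
rewrite !in_matching_of_v (inj_eq (can_inj (@tsucc_vK n m))).
have [H _] := qP z; have [H1 _] := q1P z; have := tsucc_v_neq z n1.
have [zx|zx] := eqVneq z x; have [uzx|uzx] := eqVneq (tsucc_v z) x.
- by rewrite uzx zx eqxx.
- by move=> _ /=; have := q1y _ uzx; subst z; lia.
- by move=> _ /=; have := q1y _ zx; rewrite uzx in H H1 *; lia.
- by move=> _ /=; have := q1y _ zx; have := q1y _ uzx; lia.
Qed.

Lemma odd_absz_height (n m : nat) (M : {set tedge n m}) (y : tvert n m) :
  odd `|height M y| =
  \big[addb/false]_(0 <= j < 2 * n + 1) ((iter j.+1 (@tsucc_v n m) y, false) \in M).
Proof.
rewrite /height (big_morph (fun z : int => odd `|z|) (id1 := false) (op1 := addb)) //;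
  last by move=> a b; lia.
by apply: eq_bigr => j _; rewrite abszM abszX exp1n mul1n absz_nat; case: (_ \in _).
Qed.

Lemma big_addb_shift (F : nat -> bool) (k : nat) : F k = F 0%N ->
  \big[addb/false]_(0 <= j < k) F j.+1 = \big[addb/false]_(0 <= j < k) F j.
Proof.
case: k => [|k] Fk; first by rewrite !big_nil.
by rewrite big_nat_recr // big_nat_recl //= Fk addbC.
Qed.

(** Modulo 2 the height counts the horizontal edges of a column, and a flip toggles two of them in
    the same column, at [x] and at [tsucc_v x]. *)
Lemma resonance_adj_parity (n m : nat) (M M' : PM n m) (y : tvert n m) :
  (1 <= n)%N -> resonance_adj M M' -> odd `|height (val M) y| = odd `|height (val M') y|.
Proof.
move=> n1 /existsP[x /eqP MM'].
have e z : ((z, false) \in val M') = ((z, false) \in val M) (+) (z == x) (+) (z == tsucc_v x).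
  have := congr1 (fun A : {set _} => (z, false) \in A) MM'.
  rewrite /symdiff /face_boundary !in_setU !in_setD !in_set1 !xpair_eqE /=.
  rewrite !andbT !andbF !orbF.
  have [->|_] := eqVneq z x; last by case: (_ \in _); case: (_ \in _); case: (_ == _).
  by rewrite (eq_sym x) (negbTE (tsucc_v_neq x n1)); case: (_ \in _); case: (_ \in _).
rewrite !odd_absz_height; under [RHS]eq_bigr => j _ do rewrite e.
rewrite !big_split /= -[LHS]addbF -addbA; congr (_ (+) _).
under [X in _ = _ (+) X]eq_bigr => j _.
  rewrite (inj_eq (can_inj (@tsucc_vK n m))); over.
rewrite -(big_addb_shift (F := fun j => iter j (@tsucc_v n m) y == x)).
  by rewrite addbb.
by rewrite iter_tsucc_v_id.
Qed.

(** * Descent between matchings of equal parity *)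

(* On the double cover, take a face of maximal height [F] among those where the
   height of [q] exceeds that of [q']: each neighbour of larger height would
   belong to the same set, so the face is a local maximum and can be lowered. *)
Lemma height_descent (n m : nat) (q q' : tvert n m -> int) (x0 : tvert n m) :
  (1 <= n)%N -> (2 <= m)%N -> is_height q -> is_height q' ->
  (forall x, odd `|q x| = odd `|q' x|) -> q x0 != q' x0 ->
  exists x (d : int), [/\ d != 0, is_height (fun y => q y + (if y == x then d else 0)) &
                 (`|(q x + d - q' x)%R| < `|(q x - q' x)%R|)%N].
Proof.
move=> n1 m2 qP q'P par neq0.
(* The branch selects the sheet over [x] on which the height of [q] exceeds that of [q']. A step up
   is the larger of the two steps allowed there, so the excess persists at a higher neighbour. *)
pose F x := if q' x < q x then 4 * q x - 1 else 1 - 4 * q x.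
case: (@arg_maxP _ _ _ x0 (fun x => q x != q' x) F neq0) => x xneq xmax.
have xmaxF y : q y != q' y -> F y <= F x by exact: xmax.
exists x, (if q' x < q x then -2 else 2); split.
- by case: ifP.
- move=> z; split.
    have := tsucc_v_neq z n1.
    have [zx|zx] := eqVneq z x; have [uzx|uzx] := eqVneq (tsucc_v z) x.
    + by rewrite uzx zx eqxx.
    + move=> _; subst z; have [H _] := qP x; have [H' _] := q'P x.
      by have := xmaxF (tsucc_v x); have := par x; rewrite /F; do 2 case: ltP => ? ?; lia.
    + move=> _; have [H _] := qP z; have [H' _] := q'P z; rewrite uzx in H H' *.
      by have := xmaxF z; have := par x; rewrite /F; do 2 case: ltP => ? ?; lia.
    + by move=> _; have [H _] := qP z; lia.
  have := tsucc_u_neq z m2.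
  have [zx|zx] := eqVneq z x; have [uzx|uzx] := eqVneq (tsucc_u z) x.
  + by rewrite uzx zx eqxx.
  + move=> _; subst z; have [_ H] := qP x; have [_ H'] := q'P x.
    by have := xmaxF (tsucc_u x); have := par x; rewrite /F; do 2 case: ltP => ? ?; lia.
  + move=> _; have [_ H] := qP z; have [_ H'] := q'P z; rewrite uzx in H H' *.
    by have := xmaxF z; have := par x; rewrite /F; do 2 case: ltP => ? ?; lia.
  + by move=> _; have [_ H] := qP z; lia.
(* By parity the two values differ by at least 2, so the move does not overshoot. *)
- by have := par x; case: ltP => ?; lia.
Qed.

(** Neighbouring values have an even sum along [v] and an odd sum along [u], so one parity
    determines all. *)
Lemma height_parity_eq (n m : nat) (q q' : tvert n m -> int) (o : tvert n m) :
  is_height q -> is_height q' -> odd `|q o| = odd `|q' o| ->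
  forall x, odd `|q x| = odd `|q' x|.
Proof.
move=> qP q'P; move/(torus_ind (P := fun x => odd `|q x| = odd `|q' x|)); apply.
  by move=> x; have [_] := qP x; have [_] := q'P x; lia.
by move=> x; have [+ _] := qP x; have [+ _] := q'P x; lia.
Qed.

Lemma connect_of_parity (n m : nat) (M M' : PM n m) (o : tvert n m) :
  (1 <= n)%N -> (2 <= m)%N ->
  odd `|height (val M) o| = odd `|height (val M') o| ->
  connect (@resonance_adj n m) M M'.
Proof.
move=> n1 m2.
(* Induction on the total distance between the two height functions. *)
have [k] := ubnP (\sum_x `|(height (val M) x - height (val M') x)%R|%N).
elim: k M => // k IHk M ltk par.
have hM := is_height_height n1 m2 (valP M); have hM' := is_height_height n1 m2 (valP M').
have [/eqfunP eqh|] := boolP [forall x, height (val M) x == height (val M') x].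
  suff -> : M = M' by exact: connect0.
  apply: val_inj; rewrite /= -(heightK n1 m2 (valP M)) -(heightK n1 m2 (valP M')).
  exact: eq_matching_of.
rewrite negb_forall => /existsP[x0 neq0].
have [x [d [d0 hq1 lt1]]] := height_descent n1 m2 hM hM' (height_parity_eq hM hM' par) neq0.
move: hq1; set q1 := (fun y => _) => hq1.
pose M1 : PM n m := Sub (matching_of q1) (perfect_matching_of n1 m2 hq1).
have hM1 y : height (val M1) y = q1 y by exact: matching_ofK.
have adj1 : resonance_adj M M1.
  apply/existsP; exists x; rewrite /= -{1}(heightK n1 m2 (valP M)).
  apply/eqP/symdiff_matching_of => // [|y /negbTE yx]; rewrite /q1.
    by rewrite eqxx -subr_eq0 addrAC subrr add0r.
  by rewrite yx addr0.
apply: connect_trans (connect1 adj1) (IHk M1 _ _); last first.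
  by rewrite -par; symmetry; exact: resonance_adj_parity.
move: ltk; rewrite ltnS; apply: leq_trans; rewrite (bigD1 x) //= [X in (_ < X)%N](bigD1 x) //= -addSn.
apply: leq_add; first by rewrite hM1 /q1 eqxx.
by apply: leq_sum => y /negbTE yx; rewrite hM1 /q1 yx addr0.
Qed.

(** * The two components *)

Definition stripe (n m : nat) (b : bool) (x : tvert n m) : int := odd x.1 (+) b.

(** The alternation closes up around the torus because [2 * m] is even. *)
Lemma is_height_stripe (n m : nat) (b : bool) : is_height (@stripe n m b).
Proof.
move=> -[i j]; rewrite /stripe /=; split; first by case: (_ (+) b); [right|left].
have -> : odd (i.+1 %% (2 * m)) = ~~ odd i.
  by rewrite -[RHS]/(odd i.+1) [in RHS](divn_eq i.+1 (2 * m)) oddD !oddM andbF.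
by left; case: (odd i) b => -[].
Qed.

Local Close Scope ring_scope.

Theorem theorem4p3 (n m : nat) : 1 <= n -> 2 <= m -> num_components_Rt n m = 2.
Proof.
move=> n1 m2.
have m0 : 0 < 2 * m by lia.
have n0 : 0 < 2 * n + 1 by lia.
pose o : tvert n m := (Ordinal m0, Ordinal n0).
pose Mb b : PM n m :=
  Sub (matching_of (stripe b)) (perfect_matching_of n1 m2 (is_height_stripe b)).
pose parity (M : PM n m) := odd `|height (val M) o|.
have parMb b : parity (Mb b) = b.
  by rewrite /parity /= (matching_ofK (is_height_stripe b)) /stripe; case: b.
have adjC : symmetric (@resonance_adj n m).
  by move=> M M'; rewrite /resonance_adj /symdiff; under eq_existsb => x do rewrite setUC.
have symR : connect_sym (@resonance_adj n m) by exact: sym_connect_sym.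
have connectMb b : connect (@resonance_adj n m) (Mb b) =i [pred M | parity M == b].
  move=> M; rewrite !inE; apply/idP/eqP => [SM|<-]; last first.
    by apply: (connect_of_parity (o := o)) => //; exact: parMb.
  have closedP : closed (@resonance_adj n m) [pred M | parity M == b].
    by move=> M1 M2 /(resonance_adj_parity o n1); rewrite !inE /parity => ->.
  by have := closed_connect closedP SM; rewrite !inE parMb eqxx => /esym/eqP.
(* The complement of the component of [Mb true] is the component of [Mb false]; each counts for
   one. *)
rewrite /num_components_Rt (n_compC (connect (@resonance_adj n m) (Mb true))).
rewrite n_comp_connect // (@eq_n_comp_r _ _ _ (connect (@resonance_adj n m) (Mb false))).
  by rewrite n_comp_connect.
move=> M; rewrite connectMb [LHS]inE /= connectMb !inE; by case: (parity M).
Qed.
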